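(* Let $F:\mathbb{R}^m\to\mathbb{R}^m$ be smooth and consider the autonomous equation $\dot y=F(y)$. Let $\Psi:\mathbb{R}^m\times\mathbb{R}^m\to\mathbb{R}^m$ be smooth with $$\Psi(y,y)=F(y),\qquad \Psi_1(y,y)+\Psi_2(y,y)=F'(y)\qquad\text{for all } y,$$ where $\Psi_1,\Psi_2$ denote the partial Fréchet derivatives ($m\times m$ matrices) of $\Psi$ with respect to its first and second vector argument, respectively. Let $(\bar y_n)$ be any sequence with $\bar y_n-y_n=O(h_n)$. Then the numerical scheme $$y_{n+1}-y_n=\delta(\bar y_n,h_n)\,\Psi(y_n,y_{n+1})$$ is locally exact (namely, locally exact at $\bar y_n$ for every $n$) for $$\delta(\bar y_n,h_n)=h_n\,\varphi_1\bigl(h_nF'(\bar y_n)\bigr)\Bigl(I+h_n\,\Psi_2(\bar y_n,\bar y_n)\,\varphi_1\bigl(h_nF'(\bar y_n)\bigr)\Bigr)^{-1},$$ whenever the inverse on the right-hand side exists (which is the case for all sufficiently small $h_n$).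
   Context: Notation: $F'$ is the Jacobi matrix of $F$; $h_n>0$ is the time step; $I$ is the identity matrix; $\varphi_1(z)=(e^z-1)/z$, $\varphi_1(0)=1$, an entire function, applied to matrices through its power series. The matrix-valued function $\delta$ is required to satisfy the consistency condition $\lim_{h\to0}\delta(\bar y_n,h)/h=I$. Local exactness. Consider a one-step scheme (explicit or implicit) for $\dot y=F(y)$ whose coefficients may depend on a point $\bar y$ treated as a fixed parameter. The linearization of the scheme around $\bar y$ is obtained by substituting $y_n=\bar y+\nu_n$, $y_{n+1}=\bar y+\nu_{n+1}$ (with $\bar y$ held fixed) and keeping only terms of order at most one in $(\nu_n,\nu_{n+1})$. The linearization of the differential equation around $\bar y$ is $\dot\nu=F'(\bar y)\nu+F(\bar y)$, with $\nu=y-\bar y$; its exact discretization (the difference equation whose solution satisfies $\nu_n=\nu(t_n)$, $t_{n+1}=t_n+h_n$) is $\nu_{n+1}=e^{h_nF'(\bar y)}\nu_n+h_n\varphi_1(h_nF'(\bar y))F(\bar y)$. The scheme is locally exact at $\bar y$ if its linearization around $\bar y$, solved for $\nu_{n+1}$, is identical with this exact discretization. A scheme is locally exact if there is a sequence $\bar y_n$ with $\bar y_n-y_n=O(h_n)$ such that the scheme is locally exact at $\bar y_n$ for every $n$. *)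

(* Defs.v *)
From HB Require Import structures.
From mathcomp Require Import all_boot all_order all_algebra.
From mathcomp Require Import all_classical all_reals all_analysis.
Import Order.TTheory GRing.Theory Num.Theory.
Import numFieldNormedType.Exports.

Set Implicit Arguments.
Unset Strict Implicit.
Unset Printing Implicit Defensive.

Local Open Scope classical_set_scope.
Local Open Scope ring_scope.

(* C^k maps between finite-dimensional spaces: f is C^(k+1) when it is
   differentiable everywhere and x |-> 'd f x v is C^k for every fixed v
   (in finite dimension this is the same as x |-> 'd f x being C^k). *)
Fixpoint Ck (R : realType) (U V : normedModType R) (k : nat) (f : U -> V) :
    Prop :=
  match k with
  | 0 => continuous f
  | k'.+1 => (forall x, differentiable f x) /\
             (forall v, Ck k' (fun x => 'd f x v))
  end.

Definition smooth (R : realType) (U V : normedModType R) (f : U -> V) : Prop :=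
  forall k, Ck k f.

(* R^m is 'cV[R]_m, so that matrices act on the left.  The library's jacobian
   is for row vectors and is the transpose of this one. *)
Definition jacobi (R : realType) (m : nat) (f : 'cV[R]_m -> 'cV[R]_m)
    (x : 'cV[R]_m) : 'M[R]_m :=
  \matrix_(i, j) ('d f x (delta_mx j 0 : 'cV[R]_m)) i 0.

Definition partial1 (R : realType) (m : nat)
    (Psi : 'cV[R]_m * 'cV[R]_m -> 'cV[R]_m) (u v : 'cV[R]_m) : 'M[R]_m :=
  jacobi (fun x => Psi (x, v)) u.

Definition partial2 (R : realType) (m : nat)
    (Psi : 'cV[R]_m * 'cV[R]_m -> 'cV[R]_m) (u v : 'cV[R]_m) : 'M[R]_m :=
  jacobi (fun x => Psi (u, x)) v.

Definition mx_pseries (R : realType) (m : nat) (a : nat -> R) (A : 'M[R]_m) :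
    'M[R]_m :=
  limn (series (fun k => a k *: (A ^+ k))).

Definition expmx (R : realType) (m : nat) (A : 'M[R]_m) : 'M[R]_m :=
  mx_pseries (fun k => (k`!%:R)^-1) A.

(* (e^z - 1) / z = \sum_k z^k / (k+1)! *)
Definition phi1mx (R : realType) (m : nat) (A : 'M[R]_m) : 'M[R]_m :=
  mx_pseries (fun k => ((k.+1)`!%:R)^-1) A.

(* A one-step scheme S, explicit or implicit, is given by its residual:
   a step of size h from y to y' is  S ybar h (y, y') = 0,  the coefficients
   depending on the parameter ybar. *)
Definition scheme (R : realType) (m : nat) : Type :=
  'cV[R]_m -> R -> 'cV[R]_m * 'cV[R]_m -> 'cV[R]_m.

Definition linear_part (R : realType) (U V : normedModType R) (f : U -> V)
    (p v : U) : V :=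
  f p + 'd f p v.

Definition exact_discretization (R : realType) (m : nat)
    (F : 'cV[R]_m -> 'cV[R]_m) (ybar : 'cV[R]_m) (h : R) (nu : 'cV[R]_m) :
    'cV[R]_m :=
  expmx (h *: jacobi F ybar) *m nu
  + h *: (phi1mx (h *: jacobi F ybar) *m F ybar).

(* The equivalence says that the linearized scheme can be solved uniquely for
   nu', and that the solution is the exact discretization.  ybar is frozen in
   S ybar h before differentiating. *)
Definition locally_exact_at (R : realType) (m : nat)
    (F : 'cV[R]_m -> 'cV[R]_m) (S : scheme R m) (ybar : 'cV[R]_m) (h : R) :
    Prop :=
  differentiable (S ybar h) (ybar, ybar) /\
  forall nu nu' : 'cV[R]_m,
    linear_part (S ybar h) (ybar, ybar) (nu, nu') = 0 <->
    nu' = exact_discretization F ybar h nu.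

(* As all h n are positive, big O along n is the same as a bound
   `|ybar n - y n| <= C * h n with one C for all n. *)
Definition close_to (R : realType) (m : nat) (h : nat -> R)
    (ybar y : nat -> 'cV[R]_m) : Prop :=
  (fun n => ybar n - y n) =O_\oo (fun n => h n : R^o).

Definition locally_exact (R : realType) (m : nat) (F : 'cV[R]_m -> 'cV[R]_m)
    (S : scheme R m) (h : nat -> R) (y : nat -> 'cV[R]_m) : Prop :=
  exists ybar : nat -> 'cV[R]_m, close_to h ybar y /\
    forall n, locally_exact_at F S (ybar n) (h n).

Definition delta_scheme (R : realType) (m : nat)
    (delta : 'cV[R]_m -> R -> 'M[R]_m)
    (Psi : 'cV[R]_m * 'cV[R]_m -> 'cV[R]_m) : scheme R m :=
  fun ybar h p => (p.2 - p.1) - delta ybar h *m Psi p.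

Definition consistent (R : realType) (m : nat)
    (delta : 'cV[R]_m -> R -> 'M[R]_m) : Prop :=
  forall ybar, h^-1 *: delta ybar h @[h --> 0^'] --> (1%:M : 'M[R]_m).

Definition delta_factor (R : realType) (m : nat) (F : 'cV[R]_m -> 'cV[R]_m)
    (Psi : 'cV[R]_m * 'cV[R]_m -> 'cV[R]_m) (ybar : 'cV[R]_m) (h : R) :
    'M[R]_m :=
  1%:M + h *: (partial2 Psi ybar ybar *m phi1mx (h *: jacobi F ybar)).

(* invmx A is A itself when A is singular, so this has the intended meaning
   only when delta_factor is a unit. *)
Definition delta_exact (R : realType) (m : nat) (F : 'cV[R]_m -> 'cV[R]_m)
    (Psi : 'cV[R]_m * 'cV[R]_m -> 'cV[R]_m) (ybar : 'cV[R]_m) (h : R) :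
    'M[R]_m :=
  h *: (phi1mx (h *: jacobi F ybar) *m invmx (delta_factor F Psi ybar h)).

(* Main.v *)
Require Import Defs.
From HB Require Import structures.
From mathcomp Require Import all_boot all_order all_algebra.
From mathcomp Require Import all_classical all_reals all_analysis.
From mathcomp Require Import ring.
Import Order.TTheory GRing.Theory Num.Theory.
Import numFieldNormedType.Exports.
Local Open Scope classical_set_scope.
Local Open Scope ring_scope.

(** Write J for the Jacobi matrix of F at ybar, P1 and P2 for the partial
    derivatives of Psi at (ybar, ybar), Phi for phi_1(h J), G for I + h P2 Phi
    and D = h Phi G^-1.  Substituting the Taylor expansion of Psi, the
    linearized scheme is

      nu' - nu - D (F(ybar) + P1 nu + P2 nu') = 0.

    To solve it for nu', multiply by H = I + h Phi P2.  Since H Phi = Phi G, this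
    turns D into h Phi, so the inverse disappears:
    H (I - D P2) = H - h Phi P2 = I, and with P1 + P2 = J the equation becomes

      nu' = (I + h Phi J) nu + h Phi F(ybar).

    The identity e^A = I + phi_1(A) A, read off the two power series, identifies
    the matrix in front of nu with e^(h J), and the right-hand side is the exact
    discretization.  H is invertible whenever G is (I - D P2 is its inverse), so
    multiplying by it loses nothing.  This is [linear_scheme_solve], combined
    with the derivative of the scheme in [delta_exact_locally_exact].

    For small h, the same series argument applied to phi_1 gives
    phi_1(A) = I + psi(A) A with psi bounded by an exponential, hence
    phi_1(h J) -> I and G -> I as h -> 0.  Determinant and adjugate are
    polynomials in the entries, so being a unit is an open condition and
    inversion is continuous at units; this yields both the invertibility of G
    for small h and the consistency delta(ybar, h) / h -> I. *)

Set Implicit Arguments.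
Unset Strict Implicit.
Unset Printing Implicit Defensive.

(** * Limits of matrices *)

Section MatrixLimits.
Context {R : realType} {T : Type} {F : set_system T} {FF : Filter F}.

Lemma cvg_mx m n (f : T -> 'M[R]_(m, n)) (M : 'M[R]_(m, n)) :
  (forall i j, f x i j @[x --> F] --> M i j) -> f x @[x --> F] --> M.
Proof.
move=> fM A [P MP PA]; rewrite nbhs_simpl.
apply: (@filterS _ F _ [set x | forall i j, P i j (f x i j)]).
  by move=> x fx; apply: PA.
by apply: filter_forall => i; apply: filter_forall => j; exact: (fM i j _ (MP i j)).
Qed.

Lemma cvg_mx_coord m n (f : T -> 'M[R]_(m, n)) (M : 'M[R]_(m, n)) i j :
  f x @[x --> F] --> M -> f x i j @[x --> F] --> M i j.
Proof. exact: (continuous_cvg _ (@coord_continuous R m n i j M)). Qed.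

Lemma cvg_mulmx m n p (f : T -> 'M[R]_(m, n)) (g : T -> 'M[R]_(n, p))
    (A : 'M[R]_(m, n)) (B : 'M[R]_(n, p)) :
  f x @[x --> F] --> A -> g x @[x --> F] --> B ->
  f x *m g x @[x --> F] --> A *m B.
Proof.
move=> fA gB; apply: cvg_mx => i j; rewrite mxE.
rewrite (_ : (fun x => _) = fun x => \sum_k f x i k * g x k j); last first.
  by apply/funext => x; rewrite mxE.
apply: cvg_big => [|k _]; first exact: add_continuous.
by apply: cvgM; exact: cvg_mx_coord.
Qed.

Lemma cvg_det m (f : T -> 'M[R]_m) (A : 'M[R]_m) :
  f x @[x --> F] --> A -> \det (f x) @[x --> F] --> \det A.
Proof.
move=> fA; apply: cvg_big => [|s _]; first exact: add_continuous.
apply: cvgMr; apply: cvg_big => [|i _]; first exact: mul_continuous.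
exact: cvg_mx_coord.
Qed.

Lemma cvg_adjugate m (f : T -> 'M[R]_m) (A : 'M[R]_m) :
  f x @[x --> F] --> A -> \adj (f x) @[x --> F] --> \adj A.
Proof.
move=> fA; apply: cvg_mx => i j; rewrite mxE.
rewrite (_ : (fun x => _) = fun x => cofactor (f x) j i); last first.
  by apply/funext => x; rewrite mxE.
apply: cvgMr; apply: cvg_det; apply: cvg_mx => k l; rewrite !mxE.
rewrite (_ : (fun x => _) = fun x => f x (lift j k) (lift i l)); last first.
  by apply/funext => x; rewrite !mxE.
exact: cvg_mx_coord.
Qed.

(** The invertible matrices form an open set, being the preimage of the nonzero
    scalars under the determinant. *)
Lemma near_unitmx m (f : T -> 'M[R]_m) (A : 'M[R]_m) :
  A \in unitmx -> f x @[x --> F] --> A -> \forall x \near F, f x \in unitmx.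
Proof.
rewrite unitmxE unitfE => A0 fA; near=> x; rewrite unitmxE unitfE.
by near: x; apply: cvgr_neq0 A0; exact: cvg_det.
Unshelve. all: by end_near. Qed.

(** Cramer's formula exhibits the inverse as a continuous function of the
    entries; it describes [invmx] only on units, which is enough because the
    [f x] are eventually units. *)
Lemma cvg_invmx m (f : T -> 'M[R]_m) (A : 'M[R]_m) :
  A \in unitmx -> f x @[x --> F] --> A -> invmx (f x) @[x --> F] --> invmx A.
Proof.
move=> uA fA; rewrite {2}/invmx uA.
apply: (@cvg_trans _ ((\det (f x))^-1 *: \adj (f x) @[x --> F])).
  apply: near_eq_cvg; near=> x; rewrite /invmx ifT//.
  by near: x; exact: near_unitmx fA.
apply: cvgZ; last exact: cvg_adjugate.
by apply: cvgV; [move: uA; rewrite unitmxE unitfE|exact: cvg_det].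
Unshelve. all: by end_near. Qed.

End MatrixLimits.

(** * The maximum norm and matrix products *)

Lemma ler_mx_norm_coord (R : realType) m n (A : 'M[R]_(m, n)) i j :
  `|A i j| <= `|A|.
Proof.
rewrite -[leRHS]/(mx_norm A) mx_normrE.
exact: (le_bigmax_cond _ (fun ij : 'I_m * 'I_n => `|A ij.1 ij.2|)
  (isT : xpredT (i, j))).
Qed.

Lemma mx_norm_le (R : realType) m n (A : 'M[R]_(m, n)) (c : R) :
  0 <= c -> (forall i j, `|A i j| <= c) -> `|A| <= c.
Proof.
move=> c0 Ac; rewrite -[leLHS]/(mx_norm A) mx_normrE.
by apply/bigmax_leP; split.
Qed.

(** The maximum norm is submultiplicative only up to the number of terms in each
    entry of the product.  Attaching that factor to one of the operands makes
    [n%:R * `|B|] behave as an operator norm of [B] in iterated products. *)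
Lemma ler_norm_mulmx (R : realType) m n p (A : 'M[R]_(m, n)) (B : 'M[R]_(n, p)) :
  `|A *m B| <= `|A| * (n%:R * `|B|).
Proof.
apply: mx_norm_le => [|i j]; first by rewrite !mulr_ge0.
rewrite mxE (le_trans (ler_norm_sum _ _ _))//.
rewrite mulrCA -[n in n%:R]card_ord mulr_natl -sumr_const ler_sum// => k _.
by rewrite normrM ler_pM ?ler_mx_norm_coord.
Qed.

Lemma ler_norm_mxX (R : realType) m (A : 'M[R]_m) k :
  `|A ^+ k| <= (m%:R * `|A|) ^+ k.
Proof.
elim: k => [|k IH].
  rewrite !expr0; apply: mx_norm_le => // i j.
  by rewrite mxE; case: eqP => _; rewrite ?normr1 ?normr0.
rewrite !exprSr (le_trans (ler_norm_mulmx _ _))//.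
by rewrite ler_pM// mulr_ge0.
Qed.

(** Matrices are both complete and normed; declaring completeness on top of the
    norm gives access to the convergence of absolutely convergent series. *)
HB.instance Definition _ (R : realType) (m n : nat) :=
  Uniform_isComplete.Build 'M[R]_(m, n) cauchy_cvg.

(** * Matrix power series dominated by the exponential *)

Section PowerSeries.
Context {R : realType} {m : nat}.
Implicit Types (a : nat -> R) (A : 'M[R]_m).

(** This class contains the coefficients of exp and phi_1 and is wide enough
    for the remainders obtained by removing leading terms from them. *)
Definition exp_bounded a := forall k, `|a k| <= (k`!%:R)^-1.

Let term_le a A k : exp_bounded a ->
  `|a k *: A ^+ k| <= exp_coeff (m%:R * `|A|) k.
Proof.
move=> ab; rewrite normrZ mulrC /exp_coeff ler_pM//.
exact: ler_norm_mxX.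
Qed.

Let is_cvg_normed a A : exp_bounded a ->
  cvgn [normed series (fun k => a k *: A ^+ k)].
Proof.
move=> ab; apply: (@series_le_cvg _ _ (exp_coeff (m%:R * `|A|))) => //.
- by move=> k; rewrite normr_ge0.
- by move=> k; rewrite exp_coeff_ge0 ?mulr_ge0.
- by move=> k; exact: term_le.
- exact: is_cvg_series_exp_coeff.
Qed.

Lemma is_cvg_mx_pseries a A : exp_bounded a ->
  cvgn (series (fun k => a k *: A ^+ k)).
Proof. by move=> ab; apply: normed_cvg; exact: is_cvg_normed. Qed.

Lemma ler_norm_mx_pseries a A : exp_bounded a ->
  `|mx_pseries a A| <= expR (m%:R * `|A|).
Proof.
move=> ab; apply: (le_trans (lim_series_norm (is_cvg_normed (A := A) ab))).
apply: lim_series_le => [||k]; [exact: is_cvg_normed| |exact: term_le].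
exact: is_cvg_series_exp_coeff.
Qed.

(** Splitting off the constant term, with the remaining factor [A] on the right:
    applied to exp it produces phi_1, and applied to phi_1 a bounded remainder. *)
Lemma mx_pseries_recl a A : exp_bounded (a \o S) ->
  mx_pseries a A = a 0 *: 1%:M + mx_pseries (a \o S) A *m A.
Proof.
move=> ab; apply: cvg_lim; first exact: norm_hausdorff.
rewrite -cvg_shiftS.
rewrite (_ : (fun n => _) = fun n => a 0 *: 1%:M +
    series (fun k => (a \o S) k *: A ^+ k) n *m A); last first.
  apply/funext => n; rewrite /series/= big_nat_recl// expr0; congr (_ + _).
  rewrite mulmx_suml; apply: eq_bigr => k _.
  by rewrite exprSr -scalemxAl.
apply: cvgD; first exact: cvg_cst.
by apply: cvg_mulmx; [exact: is_cvg_mx_pseries|exact: cvg_cst].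
Qed.

Lemma exp_bounded_fact d : exp_bounded (fun k => ((k + d)`!%:R)^-1).
Proof.
move=> k; rewrite ger0_norm// lef_pV2 ?posrE ?ltr0n ?fact_gt0//.
by rewrite ler_nat leq_fact// leq_addr.
Qed.

End PowerSeries.

Lemma expmx_phi1mx (R : realType) m (A : 'M[R]_m) :
  expmx A = 1%:M + phi1mx A *m A.
Proof.
rewrite /expmx mx_pseries_recl; last first.
  by move=> k; have := @exp_bounded_fact R 1 k; rewrite addn1.
by rewrite fact0 invr1 scale1r.
Qed.

(** [phi1mx (h *: A) - 1%:M] is [h *: A] times a power series in [h *: A] that
    stays bounded by [expR (m%:R * `|A|)] as long as [`|h| <= 1]. *)
Lemma cvg_phi1mx (R : realType) m (A : 'M[R]_m) :
  phi1mx (h *: A) @[h --> (0 : R)] --> (1%:M : 'M[R]_m).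
Proof.
pose psi h := mx_pseries (fun k => ((k.+2)`!%:R)^-1) (h *: A).
have bnd2 : exp_bounded (fun k => (((k.+2)`!%:R)^-1 : R)).
  by move=> k; have := @exp_bounded_fact R 2 k; rewrite addn2.
have phiE h : phi1mx (h *: A) = 1%:M + psi h *m (h *: A).
  by rewrite /phi1mx mx_pseries_recl// invr1 scale1r.
apply/cvgrPdist_le => e e0.
have hA0 : (m%:R * expR (m%:R * `|A|)) * `|h *: A| @[h --> (0 : R)] --> (0 : R).
  rewrite -[X in _ --> X](mulr0 (m%:R * expR (m%:R * `|A|))).
  apply: cvgMr; rewrite -[X in _ --> X](normr0 'M[R]_m) -(scale0r A).
  by apply: cvg_norm; apply: cvgZr_tmp; exact: cvg_id.
have small : \forall h \near (0 : R), m%:R * expR (m%:R * `|A|) * `|h *: A| <= e.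
  apply: filterS (cvgr0_norm_le _ hA0 e e0) => h; apply: le_trans; exact: ler_norm.
near=> h.
have h1 : `|h| <= 1 by near: h; exact: (cvgr0_norm_le (@id R) cvg_id _ ltr01).
have he : m%:R * expR (m%:R * `|A|) * `|h *: A| <= e by near: h.
rewrite phiE opprD addNKr normrN.
rewrite (le_trans (ler_norm_mulmx _ _))// mulrCA mulrA (le_trans _ he)//.
rewrite ler_wpM2r// ler_wpM2l// (le_trans (ler_norm_mx_pseries _ bnd2))//.
by rewrite ler_expR ler_wpM2l// normrZ ler_piMl.
Unshelve. all: by end_near. Qed.

(** * Differentials in terms of Jacobi matrices *)

Lemma diff_jacobi (R : realType) m (f : 'cV[R]_m -> 'cV[R]_m) (x v : 'cV[R]_m) :
  'd f x v = jacobi f x *m v.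
Proof.
rewrite {1}[v]matrix_sum_delta.
rewrite (eq_bigr (fun i => v i 0 *: delta_mx i 0)); last first.
  by move=> i _; rewrite big_ord_recl big_ord0 addr0.
rewrite linear_sum; apply/colP => i; rewrite summxE mxE.
by apply: eq_bigr => j _; rewrite linearZ !mxE mulrC.
Qed.

(** By linearity of the differential the two directions separate, and each one is
    the chain rule along the affine embedding that fixes the other argument. *)
Lemma diff_partials (R : realType) m (Psi : 'cV[R]_m * 'cV[R]_m -> 'cV[R]_m)
    (u v nu nu' : 'cV[R]_m) : differentiable Psi (u, v) ->
  'd Psi (u, v) (nu, nu') = partial1 Psi u v *m nu + partial2 Psi u v *m nu'.
Proof.
move=> dPsi.
have -> : 'd Psi (u, v) (nu, nu') =
    'd Psi (u, v) (nu, 0) + 'd Psi (u, v) (0, nu').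
  rewrite -[RHS](raddfD ('d Psi (u, v))).
  by congr ('d Psi (u, v) (_, _)); rewrite ?addr0 ?add0r.
have d1 : 'd (fun x => Psi (x, v)) u nu = 'd Psi (u, v) (nu, 0).
  have dP := is_diff_pair (is_diff_id u) (is_diff_cst v u).
  have dPP :
    is_diff ((fun x => (x, v)) u) Psi ('d Psi (u, v)) by exact: differentiableP.
  have := diff_val (is_diff_def := is_diff_comp dP dPP).
  by move=> /(congr1 (@^~ nu)).
have d2 : 'd (fun x => Psi (u, x)) v nu' = 'd Psi (u, v) (0, nu').
  have dP := is_diff_pair (is_diff_cst u v) (is_diff_id v).
  have dPP :
    is_diff ((fun x => (u, x)) v) Psi ('d Psi (u, v)) by exact: differentiableP.
  have := diff_val (is_diff_def := is_diff_comp dP dPP).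
  by move=> /(congr1 (@^~ nu')).
by rewrite -d1 -d2; congr (_ + _); exact: diff_jacobi.
Qed.

Lemma mulmx_continuous (R : realType) m n p (A : 'M[R]_(m, n)) :
  continuous (mulmx A : 'M[R]_(n, p) -> 'M[R]_(m, p)).
Proof.
suff cA (x : 'M[R]_(n, p)) : A *m y @[y --> x] --> A *m x by exact: cA.
apply: (@cvg_mulmx R _ _ (nbhs_filter x)); last exact: cvg_id.
exact: (@cvg_cst _ A _ _ (nbhs_filter x)).
Qed.

Lemma is_diff_delta_scheme (R : realType) m (delta : 'cV[R]_m -> R -> 'M[R]_m)
    (Psi : 'cV[R]_m * 'cV[R]_m -> 'cV[R]_m) (ybar : 'cV[R]_m) h p :
  differentiable Psi p ->
  is_diff p (delta_scheme delta Psi ybar h)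
    (fun v => v.2 - v.1 - delta ybar h *m 'd Psi p v).
Proof.
move=> dPsi; have dPsi' := differentiableP dPsi.
have cD := @mulmx_continuous R m m 1 (delta ybar h).
have dD := differentiableP (linear_differentiable (Psi p) cD).
have dDP := is_diff_comp dPsi' dD.
rewrite diff_lin// in dDP.
have d1 : is_diff p (fst : 'cV[R]_m * 'cV[R]_m -> _) fst.
  have c1 : continuous (fst : 'cV[R]_m * 'cV[R]_m -> 'cV[R]_m).
    by move=> [x1 x2]; exact: (@cvg_fst _ _ (nbhs x1) (nbhs x2) _).
  by apply: DiffDef; [exact: linear_differentiable|rewrite diff_lin].
have d2 : is_diff p (snd : 'cV[R]_m * 'cV[R]_m -> _) snd.
  have c2 : continuous (snd : 'cV[R]_m * 'cV[R]_m -> 'cV[R]_m).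
    by move=> [x1 x2]; exact: (@cvg_snd _ _ (nbhs x1) (nbhs x2) _).
  by apply: DiffDef; [exact: linear_differentiable|rewrite diff_lin].
exact: (is_diffB (is_diffB d2 d1) dDP).
Qed.

(** * The linearized scheme *)

(** Multiplication by [H = 1%:M + h *: (Phi *m P2)], the mirror image of the
    matrix [G] inverted in [D], removes [invmx G] because [H *m Phi = Phi *m G].
    The equation is equivalent to its product with [H] because [H] is invertible,
    with inverse [1%:M - D *m P2]. *)
Lemma linear_scheme_solve (R : realType) m (h : R) (Phi J P1 P2 : 'M[R]_m)
    (b nu nu' : 'cV[R]_m) :
  P1 + P2 = J -> 1%:M + h *: (P2 *m Phi) \in unitmx ->
  let D := h *: (Phi *m invmx (1%:M + h *: (P2 *m Phi))) in
  nu' - nu - D *m (b + (P1 *m nu + P2 *m nu')) = 0 <->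
  nu' = (1%:M + h *: (Phi *m J)) *m nu + h *: (Phi *m b).
Proof.
move=> <-; set G := 1%:M + _ => uG D.
pose H := 1%:M + h *: (Phi *m P2).
have HPhi : H *m Phi = Phi *m G.
  by rewrite mulmxDl mulmxDr mul1mx mulmx1 -scalemxAl -scalemxAr mulmxA.
have HD : H *m D = h *: Phi.
  by rewrite -scalemxAr mulmxA HPhi mulmxK.
have uH : H \in unitmx.
  suff : H *m (1%:M - D *m P2) = 1%:M by move=> /mulmx1_unit[].
  by rewrite mulmxBr mulmx1 mulmxA HD -scalemxAl addrK.
have -> : (nu' - nu - D *m (b + (P1 *m nu + P2 *m nu')) = 0) <->
    H *m (nu' - nu - D *m (b + (P1 *m nu + P2 *m nu'))) = 0.
  split=> [->|/(congr1 (mulmx (invmx H)))]; first by rewrite mulmx0.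
  by rewrite mulKmx// mulmx0.
have -> : H *m (nu' - nu - D *m (b + (P1 *m nu + P2 *m nu'))) =
    nu' - ((1%:M + h *: (Phi *m (P1 + P2))) *m nu + h *: (Phi *m b)).
  rewrite mulmxBr mulmxA HD mulmxBr /H !mulmxDl !mul1mx !mulmxDr -!scalemxAl.
  (* Reading the identity entrywise turns it into one between scalars, in which
     the matrix products are atoms. *)
  rewrite !mulmxDl !mulmxA; apply/colP => i; rewrite !mxE.
  ring.
by split=> [/subr0_eq|/eqP]; last by rewrite -subr_eq0 => /eqP.
Qed.

Lemma cvg_phi1mx_dnbhs (R : realType) m (A : 'M[R]_m) :
  phi1mx (h *: A) @[h --> (0 : R)^'] --> (1%:M : 'M[R]_m).
Proof. by apply: cvg_trans (cvg_phi1mx A); apply: cvg_app; exact: nbhs_dnbhs. Qed.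

(** * The locally exact step function *)

Section Delta.
Context {R : realType} {m : nat} (F : 'cV[R]_m -> 'cV[R]_m)
  (Psi : 'cV[R]_m * 'cV[R]_m -> 'cV[R]_m).

Lemma cvg_delta_factor ybar :
  delta_factor F Psi ybar h @[h --> (0 : R)^'] --> (1%:M : 'M[R]_m).
Proof.
rewrite -[X in _ --> X]addr0; apply: cvgD; first exact: cvg_cst.
rewrite -[X in _ --> X](scale0r (partial2 Psi ybar ybar *m 1%:M)).
apply: cvgZ; first exact: (@nbhs_dnbhs R 0).
by apply: cvg_mulmx; [exact: cvg_cst|exact: cvg_phi1mx_dnbhs].
Qed.

(** For [h != 0] the factor [h] cancels and leaves
    [phi1mx (h *: jacobi F ybar) *m invmx (delta_factor F Psi ybar h)], whose two
    factors both tend to the identity. *)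
Lemma delta_exact_consistent : consistent (delta_exact F Psi).
Proof.
move=> ybar.
apply: (@cvg_trans _ (phi1mx (h *: jacobi F ybar) *m
    invmx (delta_factor F Psi ybar h) @[h --> 0^'])).
  apply: near_eq_cvg; near=> h; rewrite /delta_exact scalerA mulVf ?scale1r//.
  by near: h; exact: nbhs_dnbhs_neq.
have -> : (1%:M : 'M[R]_m) = 1%:M *m invmx 1%:M by rewrite invmx1 mulmx1.
apply: cvg_mulmx; first exact: cvg_phi1mx_dnbhs.
by apply: cvg_invmx; [exact: unitmx1|exact: cvg_delta_factor].
Unshelve. all: by end_near. Qed.

(** The value of [Psi] at [(ybar, ybar)] fixes the constant term of the
    linearization, and the sum of its partial derivatives there is what makes
    the coefficients of [nu] and [nu'] combine into [jacobi F ybar]. *)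
Lemma delta_exact_locally_exact ybar h :
  differentiable Psi (ybar, ybar) -> Psi (ybar, ybar) = F ybar ->
  partial1 Psi ybar ybar + partial2 Psi ybar ybar = jacobi F ybar ->
  delta_factor F Psi ybar h \in unitmx ->
  locally_exact_at F (delta_scheme (delta_exact F Psi) Psi) ybar h.
Proof.
move=> dPsi PsiE PE uG.
have dS := is_diff_delta_scheme (delta_exact F Psi) ybar h dPsi.
split=> [|nu nu']; first exact: (ex_diff (is_diff_def := dS)).
rewrite /exact_discretization expmx_phi1mx -scalemxAr.
rewrite -(linear_scheme_solve (F ybar) nu nu' PE uG).
rewrite /linear_part (diff_val (is_diff_def := dS)) /delta_scheme /= diff_partials//.
by rewrite subrr sub0r PsiE addrCA -opprD -mulmxDr.
Qed.

End Delta.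

(** * Local exactness *)

Theorem theorem3p1 (R : realType) (m : nat)
    (F : 'cV[R]_m -> 'cV[R]_m)
    (Psi : 'cV[R]_m * 'cV[R]_m -> 'cV[R]_m)
    (F_smooth : smooth F)
    (Psi_smooth : smooth Psi)
    (Psi_diag : forall y, Psi (y, y) = F y)
    (Psi_partials : forall y, partial1 Psi y y + partial2 Psi y y = jacobi F y) :
  (forall ybar, \forall h \near 0^'+, delta_factor F Psi ybar h \in unitmx) /\
  consistent (delta_exact F Psi) /\
  forall (h : nat -> R) (y ybar : nat -> 'cV[R]_m),
    (forall n, 0 < h n) ->
    close_to h ybar y ->
    (forall n, delta_factor F Psi (ybar n) (h n) \in unitmx ->
       locally_exact_at F (delta_scheme (delta_exact F Psi) Psi) (ybar n) (h n)) /\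
    ((forall n, delta_factor F Psi (ybar n) (h n) \in unitmx) ->
       locally_exact F (delta_scheme (delta_exact F Psi) Psi) h y).
Proof.
have exact_at ybar h : delta_factor F Psi ybar h \in unitmx ->
    locally_exact_at F (delta_scheme (delta_exact F Psi) Psi) ybar h.
  by apply: delta_exact_locally_exact => //; have [] := Psi_smooth 1%N.
split=> [ybar|]; first exact:
  (near_unitmx (unitmx1 _ _) (cvg_dnbhs_at_right (cvg_delta_factor F Psi ybar))).
split=> [|h y ybar _ ybary]; first exact: delta_exact_consistent.
split=> [n|unit_n]; first exact: (exact_at (ybar n) (h n)).
exists ybar; split=> [|n]; first exact: ybary.
exact: (exact_at (ybar n) (h n) (unit_n n)).
Qed.
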